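(* Let $f_i(x)=\phi_i(\mathbf{A}_i^\top x)$ for $i\in[n]$, where $\mathbf{A}_i\in\mathbb{R}^{d\times m}$ and $\phi_i:\mathbb{R}^m\to\mathbb{R}$ is $1/\gamma$-smooth ($\gamma>0$). Let $S$ be a proper sampling on $[n]$ with $p_i=\mathbb{P}[i\in S]$ and weights $\theta_S^i=1/p_i$. If the parameters $v_1,\dots,v_n$ satisfy the ESO inequality $$\mathbb{E}\left[\left\|\sum_{i\in S}\mathbf{A}_ih_i\right\|^2\right]\le\sum_{i=1}^np_iv_i\|h_i\|^2\qquad\text{for all }h_1,\dots,h_n\in\mathbb{R}^m,$$ then the constant $\mathcal{L}_3$ (defined in the context) satisfies $$\mathcal{L}_3\le\frac{1}{n^2\gamma^2}\sum_{i=1}^n\frac{v_i\|\mathbf{A}_i\|^2}{p_i}.$$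
   Context: $[n]=\{1,\dots,n\}$; $e\in\mathbb{R}^n$ is the all-ones vector. A sampling is a random subset $S$ of $[n]$; it is proper if $p_i>0$ for all $i$. $L$-smooth means differentiable with $L$-Lipschitz gradient. $\|\mathbf{A}_i\|$ is the spectral norm. $\theta_S$ is the diagonal matrix with entries $\theta_S^i$, $\mathbf{I}_S$ is the diagonal $0/1$ indicator matrix of $S$, and $\mathbf{G}(x)=[\nabla f_1(x),\dots,\nabla f_n(x)]$, so $\frac1n\mathbf{G}(x)\theta_S\mathbf{I}_Se=\frac1n\sum_{i\in S}\theta_S^i\nabla f_i(x)$. $\mathcal{L}_3$ is the smallest constant $\ge0$ such that for all $x,y\in\mathbb{R}^d$: $\mathbb{E}\left[\|\frac1n(\mathbf{G}(x)-\mathbf{G}(y))\theta_S\mathbf{I}_Se-\frac1n(\mathbf{G}(x)-\mathbf{G}(y))e\|^2\right]\le\mathcal{L}_3\|x-y\|^2$. *)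

(* Defs.v *)
From HB Require Import structures.
From mathcomp Require Import all_boot all_order all_algebra.
From mathcomp Require Import all_classical all_reals all_analysis.
Set Implicit Arguments.
Unset Strict Implicit.
Unset Printing Implicit Defensive.
Import Order.TTheory GRing.Theory Num.Theory.
Import numFieldNormedType.Exports.
Local Open Scope classical_set_scope.
Local Open Scope ring_scope.

(* MathComp-Analysis norms matrices by the maximum of the entries (its [`|x|]),
   so the Euclidean norm is defined explicitly.  The two norms induce the same
   topology, hence the same notion of [differentiable]. *)
Definition norm2 {R : realType} {n : nat} (x : 'cV[R]_n) : R :=
  Num.sqrt (\sum_(i < n) x i 0 ^+ 2).

(* Spectral norm = operator norm induced by the Euclidean norms. *)
Definition spectral_norm {R : realType} {d m : nat} (A : 'M[R]_(d, m)) : R :=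
  sup [set norm2 (A *m h) | h in [set h : 'cV[R]_m | norm2 h <= 1]].

Definition gradient {R : realType} {n : nat} (f : 'cV[R]_n -> R)
    (x : 'cV[R]_n) : 'cV[R]_n :=
  \col_(i < n) 'D_(delta_mx i 0) f x.

Definition smooth {R : realType} {n : nat} (L : R) (f : 'cV[R]_n -> R) : Prop :=
  (forall x, differentiable f x) /\
  (forall x y, norm2 (gradient f x - gradient f y) <= L * norm2 (x - y)).

(* The finite type {set 'I_n} carries the discrete sigma-algebra. *)
Definition random_subset {dT : measure_display} {T : measurableType dT}
    {n : nat} (S : T -> {set 'I_n}) : Prop :=
  forall C : {set 'I_n}, measurable [set w | S w = C].

Definition inclusion_prob {R : realType} {dT : measure_display}
    {T : measurableType dT} (P : probability T R) {n : nat}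
    (S : T -> {set 'I_n}) (i : 'I_n) : R :=
  fine (P [set w | i \in S w]).

Definition proper_sampling {R : realType} {dT : measure_display}
    {T : measurableType dT} (P : probability T R) {n : nat}
    (S : T -> {set 'I_n}) : Prop :=
  random_subset S /\ forall i, 0 < inclusion_prob P S i.

Definition ESO {R : realType} {dT : measure_display} {T : measurableType dT}
    (P : probability T R) {n d m : nat} (S : T -> {set 'I_n})
    (A : 'I_n -> 'M[R]_(d, m)) (v : 'I_n -> R) : Prop :=
  forall h : 'I_n -> 'cV[R]_m,
    ('E_P[fun w => (norm2 (\sum_(i in S w) A i *m h i) ^+ 2)%R] <=
     (\sum_(i < n) inclusion_prob P S i * v i * norm2 (h i) ^+ 2)%:E)%E.

Definition Gmx {R : realType} {n d : nat} (f : 'I_n -> 'cV[R]_d -> R)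
    (x : 'cV[R]_d) : 'M[R]_(d, n) :=
  \matrix_(k < d, i < n) gradient (f i) x k 0.

Definition theta_mx {R : realType} {n : nat} (theta : {set 'I_n} -> 'I_n -> R)
    (C : {set 'I_n}) : 'M[R]_n :=
  diag_mx (\row_(i < n) theta C i).

Definition indic_mx {R : realType} {n : nat} (C : {set 'I_n}) : 'M[R]_n :=
  diag_mx (\row_(i < n) (i \in C)%:R).

Definition ones {R : realType} {n : nat} : 'cV[R]_n := const_mx 1.

Definition L3_bound {R : realType} {dT : measure_display}
    {T : measurableType dT} (P : probability T R) {n d : nat}
    (S : T -> {set 'I_n}) (theta : {set 'I_n} -> 'I_n -> R)
    (f : 'I_n -> 'cV[R]_d -> R) (c : R) : Prop :=
  forall x y : 'cV[R]_d,
    ('E_P[fun w =>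
       (norm2 (n%:R^-1 *: ((Gmx f x - Gmx f y) *m theta_mx theta (S w)
                            *m indic_mx (S w) *m ones)
              - n%:R^-1 *: ((Gmx f x - Gmx f y) *m ones)) ^+ 2)%R]
     <= (c * norm2 (x - y) ^+ 2)%:E)%E.

Definition is_L3 {R : realType} {dT : measure_display}
    {T : measurableType dT} (P : probability T R) {n d : nat}
    (S : T -> {set 'I_n}) (theta : {set 'I_n} -> 'I_n -> R)
    (f : 'I_n -> 'cV[R]_d -> R) (c : R) : Prop :=
  [/\ 0 <= c, L3_bound P S theta f c &
      forall c', 0 <= c' -> L3_bound P S theta f c' -> c <= c'].

Lemma is_L3_unique {R : realType} {dT : measure_display}
    {T : measurableType dT} (P : probability T R) {n d : nat}
    (S : T -> {set 'I_n}) (theta : {set 'I_n} -> 'I_n -> R)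
    (f : 'I_n -> 'cV[R]_d -> R) (c c' : R) :
  is_L3 P S theta f c -> is_L3 P S theta f c' -> c = c'.
Proof.
move=> [c0 cP cmin] [c'0 c'P c'min].
by apply/eqP; rewrite eq_le cmin // c'min.
Qed.

(* Main.v *)
Require Import Defs.
From HB Require Import structures.
From mathcomp Require Import all_boot all_order all_algebra.
From mathcomp Require Import all_classical all_reals all_analysis.
From mathcomp Require Import measurable_realfun ring.
Set Implicit Arguments.
Unset Strict Implicit.
Unset Printing Implicit Defensive.
Import Order.TTheory GRing.Theory Num.Theory.
Import numFieldNormedType.Exports.
Local Open Scope classical_set_scope.
Local Open Scope ring_scope.

(** Write [h i] for the difference of the gradients of [phi i] at [A_i^T x] and
    at [A_i^T y]. By the chain rule the [i]-th column of [G(x) - G(y)] is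
    [A_i h_i] ([gradient_comp_tr_mulmx]). As the weights are [1 / p_i], the
    sampled sum of the [A_i h_i / p_i] over [S] has mean the full sum of the
    [A_i h_i] ([sampled_mean]), so the expectation defining the constant is a
    variance divided by [n^2]. A variance is at most the second moment
    ([variance_le_second_moment]), and the ESO inequality for the family
    [h_i / p_i] bounds that second moment by the sum of the
    [v_i |h_i|^2 / p_i] ([sampled_variance_le]). Smoothness and the bound
    [|A_i^T u| <= |A_i| |u|] ([norm2_tr_mulmx_le]) give
    [|h_i| <= |A_i| |x - y| / gamma], which yields the claimed constant.

    Multiplying by [v_i] requires a sign: the ESO inequality forces [v_i >= 0]
    when [m > 0]; when [m = 0] all the norms involved vanish ([ESO_le]).

    All expectations are of functions of [S], which takes finitely many values,
    so they are finite weighted sums ([expectation_random_subset]). The smallest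
    constant exists because the admissible constants are defined by non-strict
    linear inequalities with real coefficients: their infimum is admissible
    ([exists_least_constant]). *)

(** * Euclidean and spectral norms *)

(** Expand the nonnegative sum of the [(V a_i - D b_i)^2], where [D] is the
    inner product of [a] and [b] and [V] the squared norm of [b]. *)
Lemma Cauchy_Schwarz_sum (R : realType) (n : nat) (a b : 'I_n -> R) :
  (\sum_i a i * b i) ^+ 2 <= (\sum_i a i ^+ 2) * (\sum_i b i ^+ 2).
Proof.
set D := \sum_i _; set U := \sum_i _; set V := \sum_i _.
have V_ge0 : 0 <= V by apply: sumr_ge0 => i _; exact: sqr_ge0.
have [V0|VN0] := eqVneq V 0.
  have b0 i : b i = 0.
    apply/eqP; rewrite -sqrf_eq0; apply/eqP.
    by apply: (psumr_eq0P _ V0) => // j _; exact: sqr_ge0.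
  by rewrite /D big1 ?expr0n ?V0 ?mulr0// => i _; rewrite b0 mulr0.
have : 0 <= \sum_i (V * a i - D * b i) ^+ 2.
  by apply: sumr_ge0 => i _; exact: sqr_ge0.
have -> : \sum_i (V * a i - D * b i) ^+ 2 =
    V ^+ 2 * U - V * D * D *+ 2 + D ^+ 2 * V.
  transitivity (\sum_i (V ^+ 2 * a i ^+ 2 - (V * D *+ 2) * (a i * b i)
                        + D ^+ 2 * b i ^+ 2)).
    by apply: eq_bigr => i _; ring.
  by rewrite big_split sumrB /= -!mulr_sumr -/D -/U -/V; ring.
have -> : V ^+ 2 * U - V * D * D *+ 2 + D ^+ 2 * V = V * (U * V - D ^+ 2).
  by ring.
by rewrite pmulr_rge0 ?subr_ge0// lt_neqAle eq_sym VN0.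
Qed.

Lemma norm2_ge0 (R : realType) (n : nat) (x : 'cV[R]_n) : 0 <= norm2 x.
Proof. exact: sqrtr_ge0. Qed.

Lemma norm2_sqr (R : realType) (n : nat) (x : 'cV[R]_n) :
  norm2 x ^+ 2 = \sum_i x i 0 ^+ 2.
Proof. by rewrite sqr_sqrtr// sumr_ge0// => i _; exact: sqr_ge0. Qed.

Lemma norm2Z (R : realType) (n : nat) (a : R) (x : 'cV[R]_n) :
  norm2 (a *: x) = `|a| * norm2 x.
Proof.
rewrite /norm2 -sqrtr_sqr -sqrtrM ?sqr_ge0// mulr_sumr; congr Num.sqrt.
by apply: eq_bigr => i _; rewrite mxE exprMn.
Qed.

Lemma norm2_0 (R : realType) (n : nat) : norm2 (0 : 'cV[R]_n) = 0.
Proof. by rewrite -(scale0r 0) norm2Z normr0 mul0r. Qed.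

Lemma norm2_eq0 (R : realType) (n : nat) (x : 'cV[R]_n) :
  norm2 x = 0 -> x = 0.
Proof.
move=> x0; apply/colP => i; rewrite mxE; apply/eqP; rewrite -sqrf_eq0.
apply/eqP; have := norm2_sqr x; rewrite x0 expr0n => /esym S0.
by apply: (psumr_eq0P _ S0) => // j _; exact: sqr_ge0.
Qed.

Lemma dotmx_le_norm2 (R : realType) (n : nat) (x y : 'cV[R]_n) :
  (x^T *m y) 0 0 <= norm2 x * norm2 y.
Proof.
rewrite mxE; apply: (le_trans (ler_norm _)).
rewrite -ler_sqr ?nnegrE ?normr_ge0 ?mulr_ge0 ?norm2_ge0//.
rewrite real_normK ?num_real// exprMn !norm2_sqr.
under eq_bigr do rewrite mxE.
exact: Cauchy_Schwarz_sum.
Qed.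

Lemma norm2_sqr_dot (R : realType) (n : nat) (x : 'cV[R]_n) :
  norm2 x ^+ 2 = (x^T *m x) 0 0.
Proof. by rewrite norm2_sqr mxE; apply: eq_bigr => i _; rewrite mxE expr2. Qed.

(** The set whose supremum is the spectral norm is bounded, by the Frobenius
    norm. *)
Lemma has_sup_spectral (R : realType) (d m : nat) (A : 'M[R]_(d, m)) :
  has_sup [set norm2 (A *m h) | h in [set h : 'cV[R]_m | norm2 h <= 1]].
Proof.
split; first by exists (norm2 (A *m 0)); exists 0 => //=; rewrite norm2_0 ler01.
exists (Num.sqrt (\sum_i \sum_j A i j ^+ 2)) => _ [h /= h1 <-].
apply: ler_wsqrtr; apply: ler_sum => i _; rewrite mxE.
apply: (le_trans (Cauchy_Schwarz_sum _ _)); rewrite -norm2_sqr.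
rewrite ler_piMr ?exprn_ile1 ?norm2_ge0//.
by apply: sumr_ge0 => j _; exact: sqr_ge0.
Qed.

Lemma spectral_norm_ge0 (R : realType) (d m : nat) (A : 'M[R]_(d, m)) :
  0 <= spectral_norm A.
Proof.
apply: (le_trans (norm2_ge0 (A *m 0))).
apply: sup_upper_bound; first exact: has_sup_spectral.
by exists 0 => //=; rewrite norm2_0 ler01.
Qed.

Lemma norm2_mulmx_le (R : realType) (d m : nat) (A : 'M[R]_(d, m))
    (h : 'cV[R]_m) :
  norm2 (A *m h) <= spectral_norm A * norm2 h.
Proof.
have [/norm2_eq0 ->|hN0] := eqVneq (norm2 h) 0.
  by rewrite mulmx0 !norm2_0 mulr0.
have h_gt0 : 0 < norm2 h by rewrite lt_neqAle eq_sym hN0 norm2_ge0.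
rewrite -ler_pdivrMr//; apply: sup_upper_bound; first exact: has_sup_spectral.
exists ((norm2 h)^-1 *: h) => /=.
  by rewrite norm2Z gtr0_norm ?invr_gt0// mulVf.
by rewrite -scalemxAr norm2Z gtr0_norm ?invr_gt0// mulrC.
Qed.

(** A matrix and its transpose have the same spectral norm; only this
    inequality is needed. It comes from
    [norm2 (A^T u) ^+ 2 = <u, A A^T u> <= norm2 u * norm2 (A (A^T u))]. *)
Lemma norm2_tr_mulmx_le (R : realType) (d m : nat) (A : 'M[R]_(d, m))
    (u : 'cV[R]_d) :
  norm2 (A^T *m u) <= spectral_norm A * norm2 u.
Proof.
have [->|wN0] := eqVneq (norm2 (A^T *m u)) 0.
  by rewrite mulr_ge0 ?spectral_norm_ge0 ?norm2_ge0.
have w_gt0 : 0 < norm2 (A^T *m u) by rewrite lt_neqAle eq_sym wN0 norm2_ge0.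
rewrite -(ler_pM2r w_gt0) -expr2 norm2_sqr_dot trmx_mul trmxK -mulmxA.
apply: (le_trans (dotmx_le_norm2 _ _)).
rewrite mulrAC mulrC ler_wpM2r ?norm2_ge0//.
exact: norm2_mulmx_le.
Qed.

(** * Gradients *)

(** Directional derivatives commute with precomposition by a linear map, by
    definition; differentiability of [phi] then makes them linear in the
    direction. *)
Lemma gradient_comp_tr_mulmx (R : realType) (d m : nat) (A : 'M[R]_(d, m))
    (phi : 'cV[R]_m -> R) (x : 'cV[R]_d) :
  differentiable phi (A^T *m x) ->
  gradient (fun y => phi (A^T *m y)) x = A *m gradient phi (A^T *m x).
Proof.
move=> dphi; apply/colP => k; rewrite !mxE.
have -> : 'D_(delta_mx k 0) (fun y => phi (A^T *m y)) x =
          'D_(A^T *m delta_mx k 0) phi (A^T *m x).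
  (* Both difference quotients are the same function of the increment. *)
  apply: (congr1 (fun F : R -> R^o => lim (F @ 0^'))).
  by apply/funext => h /=; rewrite mulmxDr -scalemxAr.
have -> : A^T *m delta_mx k 0 = \sum_j A k j *: (delta_mx j 0 : 'cV[R]_m).
  apply/colP => j; rewrite -colE !mxE summxE (bigD1 j)//= !mxE !eqxx mulr1.
  by rewrite big1 ?addr0// => i ij; rewrite !mxE eq_sym (negbTE ij) mulr0.
rewrite deriveE// linear_sum; apply: eq_bigr => j _.
by rewrite linearZ mxE deriveE.
Qed.

(** * Expectations of functions of a random subset *)

(** The probability that the random subset [S] equals [C], as a real number. *)
Definition subset_prob {R : realType} {dT : measure_display}
    {T : measurableType dT} (P : probability T R) {n : nat}
    (S : T -> {set 'I_n}) (C : {set 'I_n}) : R :=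
  fine (P [set w | S w = C]).

Section RandomSubset.
Context {R : realType} {dT : measure_display} {T : measurableType dT}.
Context (P : probability T R) {n : nat} (S : T -> {set 'I_n}).
Hypothesis mS : random_subset S.

Let q := subset_prob P S.

Lemma subset_prob_ge0 C : 0 <= q C.
Proof. exact: fine_ge0. Qed.

Lemma integral_random_subset (g : {set 'I_n} -> R) :
  (forall C, 0 <= g C) ->
  (\int[P]_w (g (S w))%:E)%E = (\sum_C q C * g C)%:E.
Proof.
move=> g0.
(* [g o S] is a combination of the indicators of the events [S = C]. *)
have -> : (fun w => (g (S w))%:E) =
    (fun w => \sum_C (g C)%:E * (\1_[set w | S w = C] w)%:E)%E.
  apply/funext => w; rewrite (bigD1 (S w))//= big1 => [|C CS].
    by rewrite indicE mem_set// mule1 adde0.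
  by rewrite indicE memNset ?mule0// => /= CE; rewrite CE eqxx in CS.
have mI C : measurable_fun setT (EFin \o (\1_[set w | S w = C] : T -> R)).
  by apply/measurable_EFinP; exact: measurable_indic.
rewrite ge0_integral_sum//; last 2 first.
- by move=> C; apply: measurable_funeM; exact: mI.
- by move=> C w _; rewrite mule_ge0// lee_fin.
rewrite -sumEFin; apply: eq_bigr => C _.
rewrite ge0_integralZl_EFin//; last exact: mI.
rewrite integral_indic// setIT mulrC EFinM /q /subset_prob fineK//.
exact: fin_num_measure.
Qed.

Lemma expectation_random_subset (g : {set 'I_n} -> R) :
  (forall C, 0 <= g C) ->
  'E_P[fun w => g (S w)]%E = (\sum_C q C * g C)%:E.
Proof. by move=> g0; rewrite unlock integral_random_subset. Qed.

Lemma sum_subset_prob : \sum_C q C = 1.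
Proof.
have := @integral_random_subset (fun=> 1) (fun=> ler01).
rewrite (integral_cst P measurableT) mul1e => /esym.
rewrite [X in _ = X](@probability_setT _ _ _ P) => -[<-].
by apply: eq_bigr => C _; rewrite mulr1.
Qed.

Lemma inclusion_probE i :
  inclusion_prob P S i = \sum_(C : {set 'I_n} | i \in C) q C.
Proof.
have mi : measurable [set w | i \in S w].
  have -> : [set w | i \in S w] =
      \bigcup_(C in [set C : {set 'I_n} | i \in C]) [set w | S w = C].
    by apply/seteqP; split=> w /= => [iS|[C /= iC SC]];
      [exists (S w)|rewrite SC].
  by apply: fin_bigcup_measurable => [|C _]; [exact: finite_finset|exact: mS].
rewrite /inclusion_prob
  -[P _](_ : \int[P]_w (\1_[set w | i \in S w] w)%:E = _)%E;
  last by rewrite integral_indic// setIT.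
have -> : (fun w => (\1_[set w | i \in S w] w)%:E : \bar R) =
          (fun w => ((i \in S w)%:R)%:E).
  by apply/funext => w; rewrite indicE; congr ((nat_of_bool _)%:R%:E);
    apply/idP/idP; rewrite in_setE.
rewrite (@integral_random_subset (fun C => (i \in C)%:R))//= [RHS]big_mkcond /=.
by apply: eq_bigr => C _; case: ifP; rewrite ?mulr1 ?mulr0.
Qed.

End RandomSubset.

(** * Variance of the sampled sum *)

(** The variance of a random vector is at most its second moment. *)
Lemma variance_le_second_moment (R : realType) (I : finType) (d : nat)
    (q : I -> R) (Y : I -> 'cV[R]_d) (M : 'cV[R]_d) :
  (forall i, 0 <= q i) -> \sum_i q i = 1 -> M = \sum_i q i *: Y i ->
  \sum_i q i * norm2 (Y i - M) ^+ 2 <= \sum_i q i * norm2 (Y i) ^+ 2.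
Proof.
move=> q0 q1 ME.
under eq_bigr do rewrite norm2_sqr mulr_sumr.
under [leRHS]eq_bigr do rewrite norm2_sqr mulr_sumr.
rewrite exchange_big [leRHS]exchange_big/=; apply: ler_sum => k _.
have Mk : M k 0 = \sum_i q i * Y i k 0.
  by rewrite ME summxE; apply: eq_bigr => i _; rewrite mxE.
have -> : \sum_i q i * (Y i - M) k 0 ^+ 2 =
    \sum_i q i * Y i k 0 ^+ 2 - M k 0 ^+ 2.
  transitivity (\sum_i (q i * Y i k 0 ^+ 2 - (q i * Y i k 0) * (M k 0 *+ 2)
                        + q i * M k 0 ^+ 2)).
    by apply: eq_bigr => i _; rewrite !mxE; ring.
  by rewrite big_split sumrB /= -!mulr_suml -Mk q1; ring.
by rewrite gerBl sqr_ge0.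
Qed.

Lemma mulmx_theta_indic_ones (R : realType) (n d : nat) (D : 'M[R]_(d, n))
    (theta : {set 'I_n} -> 'I_n -> R) (C : {set 'I_n}) :
  D *m theta_mx theta C *m indic_mx C *m ones =
  \sum_(i in C) theta C i *: col i D.
Proof.
apply/colP => k; rewrite !mxE summxE [RHS]big_mkcond/=.
apply: eq_bigr => i _; rewrite !mul_mx_diag !mxE.
by case: ifP => _; rewrite ?mulr1 ?mulr0// mulrC.
Qed.

Lemma mulmx_ones (R : realType) (n d : nat) (D : 'M[R]_(d, n)) :
  D *m ones = \sum_i col i D.
Proof.
apply/colP => k; rewrite !mxE summxE; apply: eq_bigr => i _.
by rewrite !mxE mulr1.
Qed.

Section ESOBound.
Context {R : realType} {dT : measure_display} {T : measurableType dT}.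
Context (P : probability T R) {n d m : nat} (S : T -> {set 'I_n}).
Context (A : 'I_n -> 'M[R]_(d, m)) (v : 'I_n -> R).
Hypothesis properS : proper_sampling P S.
Hypothesis esoS : ESO P S A v.

Let p := inclusion_prob P S.
Let q := subset_prob P S.
Let mS : random_subset S := properS.1.
Let p_gt0 i : 0 < p i := properS.2 i.

Lemma ESO_sum (h : 'I_n -> 'cV[R]_m) :
  \sum_C q C * norm2 (\sum_(i in C) A i *m h i) ^+ 2 <=
  \sum_i p i * v i * norm2 (h i) ^+ 2.
Proof.
rewrite -lee_fin.
rewrite -(@expectation_random_subset _ _ _ P _ _ mS
  (fun C => norm2 (\sum_(i in C) A i *m h i) ^+ 2)); first exact: esoS.
by move=> C; exact: sqr_ge0.
Qed.

(** Testing the ESO inequality on the family equal to [h] at [i] and to 0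
    elsewhere gives [0 <= p i * v i * norm2 h ^+ 2]. The sign of [v i] itself
    is unconstrained when [m = 0]. *)
Lemma ESO_mul_ge0 i (h : 'cV[R]_m) : 0 <= v i * norm2 h ^+ 2.
Proof.
rewrite -(pmulr_rge0 _ (p_gt0 i)) mulrA.
have -> : p i * v i * norm2 h ^+ 2 =
    \sum_j p j * v j * norm2 (if j == i then h else 0) ^+ 2.
  rewrite (bigD1 i)//= eqxx big1 ?addr0// => j ji.
  by rewrite (negbTE ji) norm2_0 expr0n mulr0.
apply: le_trans (ESO_sum _); apply: sumr_ge0 => C _.
by rewrite mulr_ge0 ?subset_prob_ge0 ?sqr_ge0.
Qed.

(** The monotonicity step [norm2 h <= spectral_norm (A i) * b] can be multiplied
    by [v i], even though [v i] may be negative when [m = 0]: in that case both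
    sides vanish. *)
Lemma ESO_le (i : 'I_n) (h : 'cV[R]_m) (b : R) :
  norm2 h <= spectral_norm (A i) * b -> 0 <= b ->
  v i * norm2 h ^+ 2 <= v i * (spectral_norm (A i) ^+ 2 * b ^+ 2).
Proof.
move=> hb b0; have [[k kN0]|m0] := pselect (exists k : 'cV[R]_m, norm2 k != 0).
  have v0 : 0 <= v i.
    have k_gt0 : 0 < norm2 k ^+ 2 by rewrite exprn_even_gt0.
    by rewrite -(pmulr_lge0 _ k_gt0) ESO_mul_ge0.
  rewrite ler_wpM2l// -exprMn ler_sqr ?nnegrE ?norm2_ge0//.
  by rewrite mulr_ge0 ?spectral_norm_ge0.
have z (k : 'cV[R]_m) : k = 0.
  by apply/norm2_eq0/eqP; apply/negP => /negP kN0; apply: m0; exists k.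
suff -> : spectral_norm (A i) = 0.
  by rewrite (z h) norm2_0 !expr0n !mul0r !mulr0.
apply/eqP; rewrite eq_le spectral_norm_ge0 andbT.
apply: ge_sup; first by have [] := has_sup_spectral (A i).
by move=> _ [k _ <-]; rewrite (z k) mulmx0 norm2_0.
Qed.

(** With weights [1 / p i] the sampled sum is unbiased. *)
Lemma sampled_mean (g : 'I_n -> 'cV[R]_d) :
  \sum_i g i = \sum_C q C *: \sum_(i in C) (1 / p i) *: g i.
Proof.
under [RHS]eq_bigr do rewrite scaler_sumr big_mkcond/=.
rewrite exchange_big/=; apply: eq_bigr => i _.
rewrite -big_mkcond/=; under eq_bigr do rewrite scalerA.
rewrite -scaler_suml -mulr_suml -inclusion_probE// div1r divff ?scale1r//.
by rewrite gt_eqF.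
Qed.

Lemma sampled_variance_le (h : 'I_n -> 'cV[R]_m) :
  \sum_C q C * norm2 (\sum_(i in C) (1 / p i) *: (A i *m h i)
                      - \sum_i A i *m h i) ^+ 2 <=
  \sum_i v i * norm2 (h i) ^+ 2 / p i.
Proof.
apply: (le_trans (variance_le_second_moment _ _ (sampled_mean _))).
- exact: subset_prob_ge0.
- exact: sum_subset_prob.
(* The factor [1 / p i ^ 2] combines with the weight [p i] into [1 / p i]. *)
have := ESO_sum (fun i => (1 / p i) *: h i).
under eq_bigr do under eq_bigr do rewrite -scalemxAr.
move=> /le_trans; apply; apply: ler_sum => i _.
rewrite norm2Z exprMn real_normK ?num_real//.
by rewrite le_eqVlt; apply/predU1P; left; field; rewrite gt_eqF.
Qed.

End ESOBound.

(** * The smallest constant and its bound *)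

(** The least constant is the infimum of all admissible ones. Points where [N]
    vanishes impose no condition on the constant, since [F <= 0] there. *)
Lemma exists_least_constant (R : realType) (X : Type) (F N : X -> R) (c0 : R) :
  (forall x, 0 <= N x) -> 0 <= c0 -> (forall x, F x <= c0 * N x) ->
  exists2 c, [/\ 0 <= c, (forall x, F x <= c * N x) &
    forall c', 0 <= c' -> (forall x, F x <= c' * N x) -> c <= c'] & c <= c0.
Proof.
move=> N0 c00 c0P.
pose E := [set c | 0 <= c /\ forall x, F x <= c * N x].
have E0 : E c0 by [].
have lbE : has_lbound E by exists 0 => c [].
have infE c : E c -> inf E <= c by exact: ge_inf.
exists (inf E); last exact: infE.
split=> [|x|c' c'0 c'P]; last exact: infE.
  by apply: lb_le_inf; [exists c0|move=> c []].
have [Nx0|NxN0] := eqVneq (N x) 0.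
  by rewrite Nx0 mulr0; have := c0P x; rewrite Nx0 mulr0.
have Nx_gt0 : 0 < N x by rewrite lt_neqAle eq_sym NxN0 N0.
rewrite -ler_pdivrMr//; apply: lb_le_inf; first by exists c0.
by move=> c [_ cP]; rewrite ler_pdivrMr.
Qed.

Theorem lemmaH4 (R : realType) (n d m : nat) (gamma : R)
    (A : 'I_n -> 'M[R]_(d, m)) (phi : 'I_n -> 'cV[R]_m -> R)
    (dT : measure_display) (T : measurableType dT) (P : probability T R)
    (S : T -> {set 'I_n}) (v : 'I_n -> R)
    (f := fun (i : 'I_n) (x : 'cV[R]_d) => phi i ((A i)^T *m x))
    (p := inclusion_prob P S)
    (theta := fun (_ : {set 'I_n}) (i : 'I_n) => 1 / p i) :
  0 < gamma ->
  (forall i, smooth (1 / gamma) (phi i)) ->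
  proper_sampling P S ->
  ESO P S A v ->
  exists2 L3 : R, is_L3 P S theta f L3 &
    L3 <= 1 / (n%:R ^+ 2 * gamma ^+ 2) *
          \sum_(i < n) v i * spectral_norm (A i) ^+ 2 / p i.
Proof.
move=> gamma_gt0 smooth_phi properS esoS.
have [mS p_gt0] := properS.
pose q := subset_prob P S.
pose h (z : 'cV[R]_d * 'cV[R]_d) i :=
  gradient (phi i) ((A i)^T *m z.1) - gradient (phi i) ((A i)^T *m z.2).
pose Y (z : 'cV[R]_d * 'cV[R]_d) C :=
  n%:R^-1 *: ((Gmx f z.1 - Gmx f z.2) *m theta_mx theta C *m indic_mx C *m ones)
  - n%:R^-1 *: ((Gmx f z.1 - Gmx f z.2) *m ones).
(* [F (x, y)] is the expectation that the constant controls at [x] and [y]. *)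
pose F z := \sum_C q C * norm2 (Y z C) ^+ 2.
pose N (z : 'cV[R]_d * 'cV[R]_d) := norm2 (z.1 - z.2) ^+ 2.
pose B := \sum_i v i * spectral_norm (A i) ^+ 2 / p i.
pose c0 := 1 / (n%:R ^+ 2 * gamma ^+ 2) * B.
have colE z i : col i (Gmx f z.1 - Gmx f z.2) = A i *m h z i.
  rewrite /h mulmxBr -!gradient_comp_tr_mulmx; try exact: (smooth_phi i).1.
  by apply/colP => k; rewrite !mxE.
have YE z C : Y z C = n%:R^-1 *: (\sum_(i in C) (1 / p i) *: (A i *m h z i)
                                  - \sum_i A i *m h z i).
  rewrite /Y mulmx_theta_indic_ones mulmx_ones scalerBr.
  congr (_ *: _ - _ *: _).
    by apply: eq_bigr => i _; rewrite colE.
  by apply: eq_bigr => i _; rewrite colE.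
(* Each summand is nonnegative by [ESO_le] with [h = 0] and [b = 1]. *)
have B0 : 0 <= B.
  apply: sumr_ge0 => i _; rewrite divr_ge0 ?(ltW (p_gt0 i))//.
  have := @ESO_le _ _ _ P _ _ _ S A v properS esoS i 0 1.
  rewrite norm2_0 expr0n mulr0 expr1n !mulr1; apply=> //.
  exact: spectral_norm_ge0.
have c0_ge0 : 0 <= c0 by rewrite mulr_ge0// div1r invr_ge0 mulr_ge0 ?sqr_ge0.
have Fle z : F z <= c0 * N z.
  rewrite /F; under eq_bigr do rewrite YE norm2Z exprMn mulrCA.
  rewrite -mulr_sumr real_normK ?num_real//.
  have -> : c0 * N z = n%:R^-1 ^+ 2 * (B * (gamma^-1 * norm2 (z.1 - z.2)) ^+ 2).
    by rewrite /c0 /N div1r invfM exprMn !exprVn; ring.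
  rewrite ler_wpM2l ?sqr_ge0//.
  apply: (le_trans (sampled_variance_le properS esoS _)).
  rewrite mulr_suml; apply: ler_sum => i _; rewrite [leRHS]mulrAC.
  rewrite ler_wpM2r ?invr_ge0 ?(ltW (p_gt0 i))// -[leRHS]mulrA.
  apply: (ESO_le properS esoS); last first.
    by rewrite mulr_ge0 ?invr_ge0 ?norm2_ge0 ?ltW.
  apply: (le_trans ((smooth_phi i).2 _ _)).
  rewrite div1r mulrCA ler_wpM2l ?invr_ge0 ?(ltW gamma_gt0)// -mulmxBr.
  exact: norm2_tr_mulmx_le.
have N_ge0 z : 0 <= N z by exact: sqr_ge0.
have L3P c : L3_bound P S theta f c <-> forall z, F z <= c * N z.
  split=> [cP [x y]|cP x y].
    rewrite -lee_fin -expectation_random_subset//; first exact: cP.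
    by move=> C; exact: sqr_ge0.
  rewrite (@expectation_random_subset _ _ _ P _ _ mS
    (fun C => norm2 (Y (x, y) C) ^+ 2)) ?lee_fin; first exact: cP.
  by move=> C; exact: sqr_ge0.
have [c [c_ge0 cP cmin] cc0] := exists_least_constant N_ge0 c0_ge0 Fle.
exists c => //; split=> // [|c' c'_ge0 /L3P c'P]; first exact/L3P.
exact: cmin.
Qed.
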